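(* Let $G$ be a connected graph with two distinct marked vertices $x,y$, and for $n\ge 3$ let $F_n(G)=F_n(G,x,y)$ be the generalized flower graph with base graph $G$. Then $$\lim_{n\to\infty}\ \max_{u,v\in V(F_n(G))} r_{F_n(G)}(u,v)=\infty .$$
   Context: For a connected graph $H$ with vertex set $\{1,\dots,N\}$ and Laplacian matrix $L$, the resistance distance (effective resistance) between vertices $i,j$ is $r_H(i,j)=(e_i-e_j)^T L^\dagger (e_i-e_j)$, where $e_i$ is the $i$th standard unit vector and $L^\dagger$ is the Moore–Penrose pseudoinverse of $L$. Generalized flower graph: let $G$ be a graph, $x\ne y$ two vertices of $G$, and $n\ge 3$. $F_n(G,x,y)$ (written $F_n(G)$) is the graph obtained by taking $n$ vertex-disjoint copies $G_1,\dots,G_n$ of $G$ (the petals), with $x_i,y_i$ the copies of $x,y$ in $G_i$, and identifying $y_i$ with $x_{i+1}$ for $1\le i<n$ and $y_n$ with $x_1$. *)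

(* Defs.v *)
From HB Require Import structures.
From mathcomp Require Import all_boot all_order all_algebra generic_quotient.
From mathcomp Require Import all_classical all_reals all_analysis.
Set Implicit Arguments.
Unset Strict Implicit.
Unset Printing Implicit Defensive.
Import Order.TTheory GRing.Theory Num.Theory.
Import numFieldNormedType.Exports.
Local Open Scope ring_scope.
Local Open Scope quotient_scope.

(* A finite simple graph is a finite vertex type with a symmetric, irreflexive
   adjacency relation.  Matrices of the graph are indexed by the enumeration
   [enum_val : 'I_#|V| -> V] of the vertices. *)

Section Resistance.
Variable R : realType.

Definition moore_penrose m n (A : 'M[R]_(m, n)) (X : 'M[R]_(n, m)) : Prop :=
  [/\ A *m X *m A = A, X *m A *m X = X,
      (A *m X)^T = A *m X & (X *m A)^T = X *m A].

(* The default value 0 is never used: see [pinvP] and [moore_penrose_uniq]. *)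
Definition pinv m n (A : 'M[R]_(m, n)) : 'M[R]_(n, m) :=
  xget 0 [set X | moore_penrose A X].

Lemma moore_penrose_uniq m n (A : 'M[R]_(m, n)) (X Y : 'M[R]_(n, m)) :
  moore_penrose A X -> moore_penrose A Y -> X = Y.
Proof.
case=> X1 X2 X3 X4 [Y1 Y2 Y3 Y4].
have AXY : A *m X = A *m Y.
  by rewrite -X3 -{1}Y1 -(mulmxA (A *m Y)) trmx_mul Y3 X3 mulmxA X1.
have XAY : X *m A = Y *m A.
  by rewrite -X4 -{1}Y1 -mulmxA mulmxA trmx_mul Y4 X4 -mulmxA (mulmxA A) X1.
by rewrite -X2 -mulmxA AXY mulmxA XAY Y2.
Qed.

Lemma gram_unitmx m n (B : 'M[R]_(m, n)) : row_free B -> B *m B^T \in unitmx.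
Proof.
move=> Bfree; rewrite -row_free_unit -kermx_eq0; apply/eqP/row_matrixP => i.
rewrite row0; set v := row i _.
have vBB : v *m (B *m B^T) = 0 by rewrite /v -row_mul mulmx_ker row0.
have : (v *m B) *m (v *m B)^T = 0.
  by rewrite trmx_mul mulmxA -(mulmxA v) vBB mul0mx.
suff w0 (w : 'rV[R]_n) : w *m w^T = 0 -> w = 0.
  by move=> /w0 vB0; apply: (row_free_inj Bfree); rewrite /= mul0mx.
move=> /matrixP /(_ 0 0); rewrite [LHS]mxE [RHS]mxE => /eqP.
under eq_bigr do rewrite [w^T _ _]mxE -expr2.
rewrite psumr_eq0 => [/allP w0|k _]; last exact: sqr_ge0.
apply/rowP => k; rewrite [RHS]mxE; apply/eqP.
by have := w0 k (mem_index_enum _); rewrite /= sqrf_eq0.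
Qed.

(* Existence by full rank factorization. *)
Lemma moore_penrose_ex m n (A : 'M[R]_(m, n)) : exists X, moore_penrose A X.
Proof.
have [k [C [D [AE uC uD]]]] : exists k (C : 'M[R]_(m, k)) (D : 'M[R]_(k, n)),
    [/\ A = C *m D, C^T *m C \in unitmx & D *m D^T \in unitmx].
  exists (\rank A), (col_base A), (row_base A); split.
  - by rewrite mulmx_base.
  - rewrite -{2}(trmxK (col_base A)); apply: gram_unitmx.
    by rewrite /row_free mxrank_tr; exact: col_base_full.
  - by apply/gram_unitmx/row_base_free.
pose d := D^T *m invmx (D *m D^T); pose c := invmx (C^T *m C) *m C^T.
have Dd : D *m d = 1%:M by rewrite mulmxA mulmxV.
have cC : c *m C = 1%:M by rewrite -mulmxA mulVmx.
have AX : A *m (d *m c) = C *m c.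
  by rewrite AE -mulmxA (mulmxA D) Dd mul1mx.
have XA : d *m c *m A = d *m D.
  by rewrite AE -mulmxA (mulmxA c) cC mul1mx.
exists (d *m c); split.
- by rewrite AX AE -mulmxA (mulmxA c) cC mul1mx.
- by rewrite XA -mulmxA (mulmxA D) Dd mul1mx.
- by rewrite AX /c !trmx_mul trmxK trmx_inv trmx_mul trmxK mulmxA.
- by rewrite XA /d !trmx_mul trmxK trmx_inv trmx_mul trmxK mulmxA.
Qed.

Lemma pinvP m n (A : 'M[R]_(m, n)) : moore_penrose A (pinv A).
Proof.
rewrite /pinv; case: xgetP => [X _ //|noX].
by have [X /noX] := moore_penrose_ex A.
Qed.

Section Graph.
Variables (V : finType) (adj : rel V).

Definition adjacency_mx : 'M[R]_#|V| :=
  \matrix_(i, j) (adj (enum_val i) (enum_val j))%:R.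

Definition degree_mx : 'M[R]_#|V| :=
  diag_mx (\row_i #|[pred w | adj (enum_val i) w]|%:R).

Definition laplacian : 'M[R]_#|V| := degree_mx - adjacency_mx.

Definition unit_vec (u : V) : 'cV[R]_#|V| := delta_mx (enum_rank u) 0.

Definition resistance (u v : V) : R :=
  ((unit_vec u - unit_vec v)^T *m pinv laplacian *m (unit_vec u - unit_vec v))
    0 0.

Lemma resistance_refl u : resistance u u = 0.
Proof. by rewrite /resistance subrr mulmx0 mxE. Qed.

(* The default value 0 does not affect the maximum over a nonempty V, since
   [resistance u u = 0]. *)
Definition max_resistance : R :=
  \big[Num.max/0]_(u : V) \big[Num.max/0]_(v : V) resistance u v.

Lemma max_resistance_ge u v : resistance u v <= max_resistance.
Proof.
apply: le_trans (le_bigmax _ (fun u => \big[Num.max/0]_v resistance u v) u).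
exact: (le_bigmax _ (resistance u) v).
Qed.

Lemma max_resistance_attained (w : V) :
  exists u v, max_resistance = resistance u v.
Proof.
rewrite /max_resistance.
elim/big_ind: _ => [|a b [u1 [v1 ->]] [u2 [v2 ->]]|u _].
- by exists w, w; rewrite resistance_refl.
- by rewrite /Num.max; case: ifP => _; [exists u2, v2|exists u1, v1].
elim/big_ind: _ => [|a b [u1 [v1 ->]] [u2 [v2 ->]]|v _].
- by exists w, w; rewrite resistance_refl.
- by rewrite /Num.max; case: ifP => _; [exists u2, v2|exists u1, v1].
by exists u, v.
Qed.

End Graph.
End Resistance.

Section Flower.
Variables (T : finType) (e : rel T) (x y : T) (n : nat).

(* (i, z) is the copy of the vertex z in petal i (petals are numbered from 0);
   [ordS i] is i + 1 modulo n.  [petal_glue p q] says that p and q are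
   y_i and x_{i+1} for some i, indices modulo n. *)
Definition petal_glue : rel ('I_n * T) :=
  [rel p q | [&& p.2 == y, q.2 == x & q.1 == ordS p.1]].

Definition petal_eq : rel ('I_n * T) :=
  connect [rel p q | petal_glue p q || petal_glue q p].

Lemma petal_eq_refl : reflexive petal_eq.
Proof. exact: connect0. Qed.

Lemma petal_eq_sym : symmetric petal_eq.
Proof. by apply: sym_connect_sym => p q /=; rewrite orbC. Qed.

Lemma petal_eq_trans : transitive petal_eq.
Proof. exact: connect_trans. Qed.

Canonical petal_eq_equiv :=
  EquivRel petal_eq petal_eq_refl petal_eq_sym petal_eq_trans.

Definition flower_vertex := {eq_quot petal_eq_equiv}.

HB.instance Definition _ := Countable.on flower_vertex.
HB.instance Definition _ := EqQuotient.on flower_vertex.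
HB.instance Definition _ := fintype.isFinite.Build flower_vertex
  (pcan_enumP (can_pcan (@reprK _ flower_vertex))).

(* For n >= 3 identifying vertices creates neither loops nor parallel edges
   ([flower_adj_irr], [flower_edge_inj]), so this adjacency relation records all
   of the edges.  For n < 3 the graph is a junk value. *)
Definition flower_adj : rel flower_vertex :=
  [rel u v | [exists i : 'I_n, exists a : T, exists b : T,
     [&& e a b, \pi_flower_vertex (i, a) == u &
                \pi_flower_vertex (i, b) == v]]].

Lemma flower_adjP u v :
  reflect (exists i a b, [/\ e a b, \pi_flower_vertex (i, a) = u &
                              \pi_flower_vertex (i, b) = v])
          (flower_adj u v).
Proof.
apply: (iffP existsP) => [[i /existsP[a /existsP[b /and3P[eab /eqP ua /eqP ub]]]]|].
  by exists i, a, b.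
case=> i [a [b [eab ua ub]]]; exists i; apply/existsP; exists a.
by apply/existsP; exists b; rewrite eab ua ub !eqxx.
Qed.

Lemma flower_adj_sym : symmetric e -> symmetric flower_adj.
Proof.
move=> e_sym; have sub u v : flower_adj u v -> flower_adj v u.
  move=> /flower_adjP[i [a [b [eab ua ub]]]]; apply/flower_adjP.
  by exists i, b, a; rewrite e_sym.
by move=> u v; apply/idP/idP; apply: sub.
Qed.

Lemma pi_glue i : \pi_flower_vertex (i, y) = \pi_flower_vertex (ordS i, x).
Proof. by apply/eqmodP/connect1; rewrite /= /petal_glue /= !eqxx. Qed.

Lemma petal_eqE p q : x != y ->
  petal_eq p q = (let c r := if r.2 == y then (ordS r.1, x) else r in c p == c q).
Proof.
move=> xy; pose c (r : 'I_n * T) := if r.2 == y then (ordS r.1, x) else r.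
have cP r : petal_eq r (c r).
  rewrite /c; case: eqP => [ry|_]; last exact: petal_eq_refl.
  by apply: connect1; rewrite /= /petal_glue /= ry !eqxx.
rewrite -[RHS]/(c p == c q); apply/idP/eqP => [|cpq]; last first.
  by apply: petal_eq_trans (cP p) _; rewrite cpq petal_eq_sym.
have cg r s : petal_glue r s -> c r = c s.
  by case: r s => [i a] [j b] /and3P[/= /eqP-> /eqP-> /eqP->];
    rewrite /c /= eqxx (negPf xy).
case/connectP=> s; elim: s p => [|r s IHs] p /=; first by move=> _ ->.
case/andP=> pr rs lq; rewrite -(IHs r rs lq).
by case/orP: pr => /cg.
Qed.

Lemma ordS_neq (i : 'I_n) : (1 < n)%N -> ordS i != i.
Proof.
move=> n1; rewrite -val_eqE /=; have [ltn|] := ltnP i.+1 n.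
  by rewrite modn_small // gtn_eqF.
move=> len; have -> : i.+1 = n by apply/eqP; rewrite eqn_leq len ltn_ord.
rewrite modnn; apply/eqP => i0; move: len; rewrite -i0.
by rewrite leqNgt n1.
Qed.

Lemma ordS2_neq (i : 'I_n) : (2 < n)%N -> ordS (ordS i) != i.
Proof.
move=> n2; rewrite -val_eqE /= -addn1 modnDml addn1.
apply/eqP => E; have : ((i + 2) %% n == (i + 0) %% n)%N.
  by rewrite addn0 addn2 E modn_small ?ltn_ord.
by rewrite eqn_modDl mod0n modn_small.
Qed.

Lemma flower_adj_irr : (1 < n)%N -> x != y -> irreflexive e ->
  irreflexive flower_adj.
Proof.
move=> n1 xy e_irr u; apply/flower_adjP => -[i [a [b [eab <-]]]].
move=> /eqmodP; rewrite /= petal_eqE //=.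
have [bE|_] := eqVneq b y; have [aE|_] := eqVneq a y.
- by move: eab; rewrite aE bE e_irr.
- by rewrite xpair_eqE (negPf (ordS_neq i n1)).
- by rewrite xpair_eqE eq_sym (negPf (ordS_neq i n1)).
by rewrite xpair_eqE eqxx /= => /eqP ba; move: eab; rewrite ba e_irr.
Qed.

Lemma flower_edge_inj i j a b c d : (2 < n)%N -> x != y -> irreflexive e ->
  e a b -> e c d ->
  \pi_flower_vertex (i, a) = \pi_flower_vertex (j, c) ->
  \pi_flower_vertex (i, b) = \pi_flower_vertex (j, d) ->
  [/\ i = j, a = c & b = d].
Proof.
move=> n2 xy e_irr eab ecd /eqmodP + /eqmodP; rewrite /= !petal_eqE //=.
have S1 (k : 'I_n) : ordS k <> k by apply/eqP; apply: ordS_neq; exact: ltnW.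
have S2 (k : 'I_n) : ordS (ordS k) <> k by apply/eqP; exact: ordS2_neq.
have [aE|_] := eqVneq a y; have [bE|_] := eqVneq b y;
  have [cE|_] := eqVneq c y; have [dE|_] := eqVneq d y;
  rewrite ?aE ?bE ?cE ?dE ?e_irr // in eab ecd *.
all: rewrite !xpair_eqE => /andP[/eqP ? /eqP ?].
all: move=> /andP[/eqP ? /eqP ?]; move: (S1 i) (S1 j) (S2 i).
all: split; congruence.
Qed.

Lemma flower_adj_connected : (forall a b, connect e a b) ->
  forall u v, connect flower_adj u v.
Proof.
move=> e_conn u v.
have petal i a b : connect flower_adj (\pi_flower_vertex (i, a)) (\pi_flower_vertex (i, b)).
  have /connectP[s es ->] := e_conn a b.
  elim: s a es => [|c s IHs] a /=; first by rewrite connect0.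
  case/andP=> eac /IHs; apply: connect_trans; apply: connect1.
  by apply/flower_adjP; exists i, a, c.
have next i a b : connect flower_adj (\pi_flower_vertex (i, a)) (\pi_flower_vertex (ordS i, b)).
  by apply: connect_trans (petal i a y) _; rewrite pi_glue; exact: petal.
have iterS k i : val (iter k (@ordS n) i) = ((i + k) %% n)%N.
  elim: k => [|k IHk] /=; first by rewrite addn0 modn_small.
  by rewrite IHk -addn1 modnDml addn1 addnS.
rewrite -[u]reprK -[v]reprK; case: (repr u) (repr v) => [i a] [j b].
have -> : j = iter (n - i + j)%N (@ordS n) i.
  apply: val_inj; rewrite iterS addnA subnKC ?modnDl ?modn_small //.
  exact: ltnW.
elim: (n - i + j)%N b => [|k IHk] b; first exact: petal.
by apply: connect_trans (IHk b) _; exact: next.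
Qed.

End Flower.

(* Main.v *)
Require Import Defs.
From HB Require Import structures.
From mathcomp Require Import all_boot all_order all_algebra.
From mathcomp Require Import all_classical all_reals all_analysis.
From mathcomp Require Import generic_quotient zify ring lra.
Set Implicit Arguments.
Unset Strict Implicit.
Unset Printing Implicit Defensive.
Import Order.TTheory GRing.Theory Num.Theory.
Import numFieldNormedType.Exports.
Local Open Scope classical_set_scope.
Local Open Scope ring_scope.

(** Dirichlet's principle bounds the effective resistance from below: every
    potential [f] satisfies [r(u,v) >= 2 (f u - f v) - E(f)], where [E] is the
    Dirichlet energy, because [E(g - f) >= 0] for the potential [g] of the unit
    current flow from [u] to [v].  On the flower take for [f] a multiple of the
    distance [min(i, n - i)] around the cycle of petals, concentrated at the
    junctions: it changes by at most one unit along each of the at most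
    [n |T|^2] edges and differs by [n / 2] between opposite junctions, which
    gives a resistance growing linearly in [n]. *)

(** * Dirichlet energy, the Laplacian and effective resistance *)

Section Dirichlet.
Variables (R : realType) (V : finType) (adj : rel V).
Hypothesis adj_sym : symmetric adj.

(** The factor 1/2 compensates for the sum over ordered pairs, in which each edge occurs twice. *)
Definition energy (f : V -> R) : R :=
  2^-1 * \sum_u \sum_v (adj u v)%:R * (f u - f v) ^+ 2.

Definition potential_vec (f : V -> R) : 'cV[R]_#|V| := \col_i f (enum_val i).

Local Notation L := (laplacian R adj).

Lemma energy_ge0 f : 0 <= energy f.
Proof.
rewrite mulr_ge0 ?invr_ge0 ?ler0n // sumr_ge0 // => u _.
by rewrite sumr_ge0 // => v _; rewrite mulr_ge0 ?ler0n ?sqr_ge0.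
Qed.

Lemma potential_vecE (w : 'cV[R]_#|V|) :
  potential_vec (fun u => w (enum_rank u) 0) = w.
Proof. by apply/colP => i; rewrite mxE enum_valK. Qed.

Lemma laplacian_tr : L^T = L.
Proof.
rewrite /laplacian linearB /= tr_diag_mx; congr (_ - _).
by apply/matrixP => i j; rewrite !mxE adj_sym.
Qed.

Lemma laplacian_energy f :
  ((potential_vec f)^T *m L *m potential_vec f) 0 0 = energy f.
Proof.
have deg_sum : \sum_u \sum_v (adj u v)%:R * f u ^+ 2 =
    \sum_u #|[pred v | adj u v]|%:R * f u ^+ 2.
  apply: eq_bigr => u _; rewrite -mulr_suml -natr_sum; congr (_%:R * _).
  by rewrite -sum1_card [RHS]big_mkcond.
have deg_sum' : \sum_u \sum_v (adj u v)%:R * f v ^+ 2 =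
    \sum_u #|[pred v | adj u v]|%:R * f u ^+ 2.
  rewrite exchange_big -deg_sum; apply: eq_bigr => u _; apply: eq_bigr => v _.
  by rewrite adj_sym.
rewrite /energy.
transitivity (\sum_u #|[pred v | adj u v]|%:R * f u ^+ 2 -
    \sum_u \sum_v (adj u v)%:R * (f u * f v)).
  rewrite -mulmxA /laplacian mulmxBl mulmxBr mxE [X in _ + X]mxE; congr (_ - _).
    rewrite mul_diag_mx mxE (reindex _ (onW_bij _ (enum_val_bij V))) /=.
    by apply: eq_bigr => i _; rewrite !mxE; ring.
  rewrite mxE (reindex _ (onW_bij _ (enum_val_bij V))) /=.
  apply: eq_bigr => i _; rewrite !mxE mulr_sumr.
  rewrite [RHS](reindex _ (onW_bij _ (enum_val_bij V))) /=.
  by apply: eq_bigr => j _; rewrite !mxE; ring.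
have -> : \sum_u \sum_v (adj u v)%:R * (f u - f v) ^+ 2 =
    \sum_u \sum_v (adj u v)%:R * f u ^+ 2 +
    \sum_u \sum_v (adj u v)%:R * f v ^+ 2 -
    2 * \sum_u \sum_v (adj u v)%:R * (f u * f v).
  rewrite mulr_sumr -big_split -sumrB; apply: eq_bigr => u _ /=.
  rewrite mulr_sumr -big_split -sumrB; apply: eq_bigr => v _ /=; ring.
by rewrite deg_sum deg_sum'; field.
Qed.

Lemma energy_eq0 f : (forall u v, connect adj u v) -> energy f = 0 ->
  forall u v, f u = f v.
Proof.
move=> conn /eqP; rewrite mulf_eq0 invr_eq0 pnatr_eq0 /=.
have pos u v : 0 <= (adj u v)%:R * (f u - f v) ^+ 2.
  by rewrite mulr_ge0 ?ler0n ?sqr_ge0.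
rewrite psumr_eq0 => [/allP E0|u _]; last exact: sumr_ge0.
have step u v : adj u v -> f u = f v.
  move=> uv; have := E0 u (mem_index_enum _).
  rewrite /= psumr_eq0 => [/allP /(_ v (mem_index_enum _))|w _ //].
  by rewrite /= uv mul1r sqrf_eq0 subr_eq0 => /eqP.
move=> u v; have /connectP[s us ->] := conn u v.
elim: s u us => //= w s IHs u /andP[/step -> /IHs]; exact.
Qed.

Lemma tr_potential_unit f u v :
  ((potential_vec f)^T *m (unit_vec R u - unit_vec R v)) 0 0 = f u - f v.
Proof.
by rewrite mulmxBr mxE [X in _ + X]mxE -!colE !mxE !enum_rankK.
Qed.

(** [L *m pinv L] is the orthogonal projection onto the range of [L]. By connectedness the kernel of
    the symmetric [L] consists of the constants, and the difference of two unit vectors is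
    orthogonal to these. *)
Lemma laplacian_pinv_unit u v : (forall u v, connect adj u v) ->
  L *m (Defs.pinv L *m (unit_vec R u - unit_vec R v)) = unit_vec R u - unit_vec R v.
Proof.
move=> conn; set b := _ - _; have [LXL _ LXs _] := Defs.pinvP L.
set P := L *m Defs.pinv L in LXL LXs.
pose w := b - P *m b.
(* [w] is the component of [b] in the kernel of [L], i.e. in the constants. *)
have Lw : L *m w = 0.
  (* Transpose [L *m pinv L *m L = L], using that [L] and [P] are symmetric. *)
  have LP : L *m P = L by rewrite -{1}laplacian_tr -LXs -trmx_mul LXL laplacian_tr.
  by rewrite mulmxBr mulmxA LP subrr.
have PP : P *m P = P by rewrite {2}/P mulmxA LXL.
pose f u := w (enum_rank u) 0.
have wE : w = potential_vec f by rewrite potential_vecE.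
have fc : f u = f v.
  apply: energy_eq0 => //.
  by rewrite -laplacian_energy -wE -mulmxA Lw mulmx0 mxE.
(* [w] is orthogonal to the range of [P], so its squared norm is [w^T *m b], which is
   [f u - f v]. *)
have ww : (w^T *m w) 0 0 = 0.
  have -> : w^T *m w = w^T *m b.
    rewrite {2}/w mulmxBr mulmxA.
    have -> : w^T *m P = 0.
      by rewrite /w linearB /= trmx_mul LXs mulmxBl -mulmxA PP subrr.
    by rewrite mul0mx subr0.
  by rewrite wE tr_potential_unit fc subrr.
have w0 : w = 0.
  move: ww; rewrite mxE => /eqP.
  under eq_bigr do rewrite [w^T _ _]mxE -expr2.
  rewrite psumr_eq0 => [/allP ww|k _]; last exact: sqr_ge0.
  apply/colP => k; rewrite [RHS]mxE; apply/eqP.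
  by have := ww k (mem_index_enum _); rewrite /= sqrf_eq0.
by rewrite mulmxA -/P; apply/esym/eqP; rewrite -subr_eq0; apply/eqP.
Qed.

Lemma resistance_ge f u v : (forall u v, connect adj u v) ->
  2 * (f u - f v) - energy f <= resistance R adj u v.
Proof.
move=> conn; have := laplacian_pinv_unit u v conn.
set b := unit_vec R u - _; set w := Defs.pinv L *m b => Lw.
pose g u := w (enum_rank u) 0.
have wE : potential_vec g = w by rewrite potential_vecE.
have rE : resistance R adj u v = g u - g v.
  rewrite -tr_potential_unit wE -/b /resistance -/b -mulmxA -/w.
  by rewrite -[w^T *m b]trmxK trmx_mul trmxK [RHS]mxE.
have := energy_ge0 (fun z => g z - f z).
rewrite -laplacian_energy.
have -> : potential_vec (fun z => g z - f z) = w - potential_vec f.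
  by rewrite -wE; apply/colP => i; rewrite !mxE.
have wL : w^T *m L = b^T by rewrite -{1}laplacian_tr -trmx_mul Lw.
have bf : (b^T *m potential_vec f) 0 0 = f u - f v.
  by rewrite -[_ *m _]trmxK trmx_mul trmxK mxE tr_potential_unit.
have bw : (b^T *m w) 0 0 = g u - g v.
  by rewrite -[_ *m _]trmxK trmx_mul trmxK mxE -wE tr_potential_unit.
(* Since [L *m w = b], the energy of [g - f] expands to [r(u,v) - 2 (f u - f v) + E(f)]. *)
rewrite [(_ - _)^T]linearB /= mulmxBl wL mulmxBl !(mulmxBr _ w) -(mulmxA _ L w) Lw.
have mxB (A B : 'M[R]_1) : (A - B) 0 0 = A 0 0 - B 0 0 by rewrite !mxE.
rewrite !mxB bf bw tr_potential_unit laplacian_energy rE; lra.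
Qed.

Lemma energy_le f (c : R) : (forall u v, adj u v -> `|f u - f v| <= c) ->
  energy f <= c ^+ 2 * #|[pred p : V * V | adj p.1 p.2]|%:R.
Proof.
move=> fc; rewrite /energy pair_big /=.
have -> : c ^+ 2 * #|[pred p : V * V | adj p.1 p.2]|%:R =
    \sum_(p : V * V) (adj p.1 p.2)%:R * c ^+ 2.
  rewrite -mulr_suml -natr_sum mulrC -sum1_card.
  by congr (_%:R * _); rewrite [LHS]big_mkcond.
have sum_le : \sum_(p : V * V) (adj p.1 p.2)%:R * (f p.1 - f p.2) ^+ 2 <=
    \sum_(p : V * V) (adj p.1 p.2)%:R * c ^+ 2.
  apply: ler_sum => -[u v] _ /=; have [uv|_] := boolP (adj u v); last first.
    by rewrite !mul0r.
  rewrite !mul1r -[leLHS]real_normK ?num_real // ler_pXn2r ?nnegrE //.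
    exact: fc.
  exact: le_trans (fc u v uv).
(* Nonnegativity of the sum allows the factor 1/2 of the energy to be dropped. *)
have sum_ge0 : 0 <= \sum_(p : V * V) (adj p.1 p.2)%:R * (f p.1 - f p.2) ^+ 2.
  by apply: sumr_ge0 => p _; rewrite mulr_ge0 ?ler0n ?sqr_ge0.
lra.
Qed.

End Dirichlet.

(** * Edge count and height function of the flower *)

Section FlowerPotential.
Variables (T : finType) (e : rel T) (x y : T).
Hypothesis x_neq_y : x != y.

(** Each adjacent ordered pair is the image under [ends] of a petal index and two vertices of the
    base graph. *)
Lemma card_flower_adj n :
  (#|[pred p : flower_vertex x y n * flower_vertex x y n |
      @flower_adj T e x y n p.1 p.2]| <= n * #|T| ^ 2)%N.
Proof.
have -> : (n * #|T| ^ 2 = #|{: 'I_n * T * T}|)%N.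
  by rewrite !card_prod card_ord -mulnA mulnn.
pose ends (q : 'I_n * T * T) : flower_vertex x y n * flower_vertex x y n :=
  (\pi_(flower_vertex x y n) q.1, \pi_(flower_vertex x y n) (q.1.1, q.2))%qT.
apply: leq_trans (leq_image_card ends predT).
apply: subset_leq_card; apply/fintype.subsetP => -[u v].
rewrite inE /= => /flower_adjP[i [a [b [_ <- <-]]]].
by apply/fintype.imageP; exists (i, a, b).
Qed.

(* Every vertex of a petal other than [y_i] sits at the height of [x_i]. *)
Definition flower_height n (u : flower_vertex x y n) : nat :=
  let p := repr u in let i := if p.2 == y then ordS p.1 else p.1 in
  minn i (n - i).

(** The height does not depend on the representative: by [petal_eqE], equivalent points agree once
    each [y_i] is rewritten as [x_{i+1}]. *)
Lemma flower_height_pi n (i : 'I_n) (z : T) :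
  flower_height (\pi_(flower_vertex x y n) (i, z))%qT =
  (let j := if z == y then ordS i else i in minn j (n - j)).
Proof.
rewrite /flower_height; case: piP => q /eqmodP; rewrite /= petal_eqE // => qz.
suff -> : (if q.2 == y then ordS q.1 else q.1) = if z == y then ordS i else i.
  by [].
by move: qz => /eqP /(congr1 fst); case: (z == y); case: (q.2 == y).
Qed.

Lemma flower_height_adj n (u v : flower_vertex x y n) :
  flower_adj e u v -> (flower_height u <= (flower_height v).+1)%N.
Proof.
case/flower_adjP=> i [a [b [_ <- <-]]]; rewrite !flower_height_pi /=.
have := ltn_ord i.
(* In the last petal the index wraps around to 0, where the height falls from at most 1 to 0. *)
have oS : ordS i = (if i.+1 == n then 0 else i.+1)%N :> nat.
  rewrite /=; case: eqP => [->|/eqP ne]; first by rewrite modnn.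
  by rewrite modn_small // ltn_neqAle ne ltn_ord.
by case: (a == y); case: (b == y); rewrite ?oS; case: (i.+1 =P n); lia.
Qed.

End FlowerPotential.

Lemma max_resistance_flower_ge (R : realType) (T : finType) (e : rel T)
    (x y : T) (n : nat) :
  symmetric e -> (forall a b, connect e a b) -> x != y -> (1 < n)%N ->
  n%:R / (9 * #|T|%:R ^+ 2) <= max_resistance R (@flower_adj T e x y n).
Proof.
move=> e_sym e_conn xy n1.
have T0 : (0 < #|T|)%N by apply/card_gt0P; exists x.
set K : R := #|T|%:R ^+ 2; have K0 : 0 < K by rewrite exprn_gt0 // ltr0n.
have n0 : (0 < n)%N by lia.
have m0 : (n./2 < n)%N by lia.
pose u := (\pi_(flower_vertex x y n) (Ordinal m0, x))%qT.
pose v := (\pi_(flower_vertex x y n) (Ordinal n0, x))%qT.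
(* This value maximizes [2 c n / 3 - c^2 n K], the lower bound that Dirichlet's principle gives for
   the potential [f]; the maximum is [n / (9 K)]. *)
pose c : R := (3 * K)^-1; have c0 : 0 < c by rewrite invr_gt0 mulr_gt0.
pose f (z : flower_vertex x y n) : R := c * (flower_height z)%:R.
apply: le_trans (max_resistance_ge _ _ u v).
have sym := flower_adj_sym (x := x) (y := y) (n := n) e_sym.
have conn := flower_adj_connected (x := x) (y := y) (n := n) e_conn.
apply: le_trans (resistance_ge sym f u v conn).
have fc a b : flower_adj e a b -> `|f a - f b| <= c.
  move=> ab; rewrite -mulrBr normrM gtr0_norm // ler_piMr ?(ltW c0) //.
  have := flower_height_adj xy ab.
  have := flower_height_adj xy (etrans (sym b a) ab).
  rewrite -!(ler_nat R) -!natr1 ler_norml => h1 h2; apply/andP; split; lra.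
have := energy_le fc.
have : (#|[pred p : flower_vertex x y n * flower_vertex x y n |
          @flower_adj T e x y n p.1 p.2]|)%:R <= n%:R * K.
  by rewrite /K -natrX -natrM ler_nat; exact: card_flower_adj.
clearbody K; have Kn0 : K != 0 by rewrite gt_eqF.
move: (energy _ _) (#|_|) => E N NK EN.
have EK : E <= c ^+ 2 * (n%:R * K) by apply: le_trans EN _; rewrite ler_wpM2l ?sqr_ge0.
have fu : f u - f v = c * (n./2)%:R.
  rewrite /f !flower_height_pi //= (negPf xy) /= min0n mulr0 subr0.
  by congr (_ * _%:R); lia.
(* The rounding in [n./2] costs most at [n = 3], where equality holds; this is the source of the
   factor 3 in [c]. *)
have n3 : n%:R <= 3 * (n./2)%:R :> R by rewrite -natrM ler_nat; lia.
have cn : c * n%:R <= c * (3 * (n./2)%:R) by rewrite ler_wpM2l ?(ltW c0).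
have cK : c ^+ 2 * (n%:R * K) = c * n%:R / 3.
  by rewrite /c; field.
have -> : n%:R / (9 * K) = c * n%:R / 3 by rewrite /c; field.
rewrite fu; lra.
Qed.

Theorem corollary3p6 (R : realType) (T : finType) (e : rel T) (x y : T)
    (e_sym : symmetric e) (e_irr : irreflexive e)
    (e_conn : forall a b : T, connect e a b) (x_neq_y : x != y) :
  max_resistance R (@flower_adj T e x y n) @[n --> \oo] --> +oo.
Proof.
have T0 : (0 < #|T|)%N by apply/card_gt0P; exists x.
have K0 : 0 < 9 * #|T|%:R ^+ 2 :> R by rewrite mulr_gt0 // exprn_gt0 // ltr0n.
apply/cvgryPge => A; near=> n.
apply: le_trans (max_resistance_flower_ge _ e_sym e_conn x_neq_y _); last first.
  by near: n; exact: nbhs_infty_gt.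
rewrite ler_pdivlMr //; near: n; exact: nbhs_infty_ger.
Unshelve. all: by end_near.
Qed.
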